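(* Let $\kappa>\lambda\geq\omega$ be cardinals. For infinite cardinals $\kappa,\nu,\mu$ with $\kappa=\nu+\mu$ write $[\kappa]^{\nu|\mu}=\{A\subseteq\kappa: |A|=\nu \text{ and } |\kappa\setminus A|=\mu\}$, partially ordered by inclusion. Then: (a) A linear order $L$ is isomorphic to a maximal chain in $\langle [\kappa]^{\kappa|\kappa},\subseteq\rangle$ if and only if $L$ is weakly Boolean and $w((-\infty,a]_L)=w([a,\infty)_L)=\kappa$ for each $a\in L$. (b) A linear order $L$ is isomorphic to a maximal chain in $\langle [\kappa]^{\lambda|\kappa},\subseteq\rangle$ if and only if $L$ is weakly Boolean and $w((-\infty,a]_L)=\lambda$ and $w([a,\infty)_L)=\lambda^+$ for each $a\in L$. (c) A linear order $L$ is isomorphic to a maximal chain in $\langle [\kappa]^{\kappa|\lambda},\subseteq\rangle$ if and only if $L$ is weakly Boolean and $w((-\infty,a]_L)=\lambda^+$ and $w([a,\infty)_L)=\lambda$ for each $a\in L$.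
   Context: A linear order $L$ is Dedekind-complete if it has no gaps, i.e. every nonempty subset with an upper bound has a supremum. $L$ has dense jumps if for all $a<b$ in $L$ there are $c<d$ in $[a,b]_L$ with $(c,d)_L=\emptyset$. $L$ is weakly Boolean if it is Dedekind-complete and has dense jumps. A subset $D\subseteq L$ is weakly dense in $L$ if for all $x<y$ in $L$ there is $z\in D$ with $x\leq z\leq y$. The weight of $L$ is $w(L)=\min\{|D|: D\subseteq L \text{ weakly dense in } L\}$. Intervals $(-\infty,a]_L=\{x\in L:x\le a\}$ and $[a,\infty)_L=\{x\in L: x\ge a\}$ carry the induced order. *)

(* Defs.v *)
From mathcomp Require Import all_boot all_order.
From mathcomp Require Import boolp classical_sets functions cardinality.

Set Implicit Arguments.
Unset Strict Implicit.
Unset Printing Implicit Defensive.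

Local Open Scope classical_set_scope.
Local Open Scope card_scope.
Local Open Scope order_scope.

(* A cardinal is represented by a type of that cardinality; the statements are
   invariant under bijection. *)

Definition card_lt (A B : Type) : Prop :=
  [set: A] #<= [set: B] /\ ~ ([set: B] #<= [set: A]).

Definition is_succ_cardinal (A S : Type) : Prop :=
  card_lt A S /\ forall B : Type, card_lt A B -> [set: S] #<= [set: B].

Section LinearOrders.
Context {d : Order.disp_t} {L : orderType d}.

Definition dedekind_complete : Prop :=
  forall A : set L, A !=set0 -> has_ubound A -> supremums A !=set0.

Definition dense_jumps : Prop :=
  forall a b : L, a < b ->
    exists c e : L, [/\ a <= c, c < e, e <= b & [set x | c < x < e] = set0].

Definition weakly_boolean : Prop := dedekind_complete /\ dense_jumps.

(* A subset [X] of [L] stands for the linear order it carries by restriction. *)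
Definition weakly_dense (X D : set L) : Prop :=
  D `<=` X /\
  forall x y, X x -> X y -> x < y -> exists2 z, D z & x <= z <= y.

(* w(X) = |W| *)
Definition has_weight (X : set L) (W : Type) : Prop :=
  (exists2 D, weakly_dense X D & D #= [set: W]) /\
  (forall D, weakly_dense X D -> [set: W] #<= D).

(* w(X) is the successor cardinal of |A| *)
Definition has_succ_weight (X : set L) (A : Type) : Prop :=
  exists2 S : Type, is_succ_cardinal A S & has_weight X S.

Definition lower_ray (a : L) : set L := [set x | x <= a].
Definition upper_ray (a : L) : set L := [set x | a <= x].

End LinearOrders.

Arguments dedekind_complete {d} L.
Arguments dense_jumps {d} L.
Arguments weakly_boolean {d} L.

(* [K]^{N|M} *)
Definition split_subsets (K N M : Type) : set (set K) :=
  [set A | A #= [set: N] /\ ~` A #= [set: M]].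

Arguments split_subsets : clear implicits.

Definition maximal_chain (T : Type) (P C : set (set T)) : Prop :=
  [/\ C `<=` P, total_on C subset &
      forall C', C' `<=` P -> total_on C' subset -> C `<=` C' -> C' = C].

Definition order_isomorphic d (L : orderType d) (T : Type) (C : set (set T)) :=
  exists f : L -> set T,
    range f = C /\ forall x y, x <= y <-> f x `<=` f y.

Definition iso_to_maximal_chain d (L : orderType d) T (P : set (set T)) :=
  exists2 C, maximal_chain P C & order_isomorphic L C.

(* Main.v *)
Require Import Defs.
From mathcomp Require Import all_boot all_order.
From mathcomp Require Import boolp classical_sets functions cardinality.

(* For a weakly Boolean order [L] let [J] be the set of right endpoints of the
   jumps of [L].  Every weakly dense set meets each jump, and the endpoints of the
   jumps are weakly dense, so the weight of a ray is the number of its jumps.  In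
   a maximal chain each jump adds exactly one point, so the jumps below [f a]
   correspond to the points of [f a] outside the intersection of the chain and the
   jumps above [f a] to the points of its union outside [f a]; maximality prevents
   this intersection and this union from belonging to the poset, which determines
   the two cardinals.  A successor cardinal appears because a chain of sets of size
   at most [Lam] has a union of size at most any cardinal greater than [Lam].
   Conversely [x |-> J `&` ]-oo, x]], transported into [K] and padded with the
   points outside the image of [J] in the third case, is a maximal chain. *)

Set Implicit Arguments.
Unset Strict Implicit.
Unset Printing Implicit Defensive.

Import Order.TTheory.

Local Open Scope order_scope.
Local Open Scope classical_set_scope.
Local Open Scope card_scope.

(** * Cardinal arithmetic *)

Section CardinalArithmetic.

(** Relations are convenient for injections defined by cases or by choice; the axiom of choice
    extracts a map between the subtypes. *)
Lemma card_le_rel T U (A : set T) (B : set U) (R : T -> U -> Prop) :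
  (forall a, A a -> exists2 b, B b & R a b) ->
  (forall a a' b, A a -> A a' -> R a b -> R a' b -> a = a') ->
  A #<= B.
Proof.
move=> Rtot Rinj.
have /choice[f fP] (a : A) : exists b : B, R (val a) (val b).
  have [b Bb Rab] := Rtot _ (set_valP a).
  by exists (SigSub (mem_set Bb)).
apply/card_leP; apply/injfunPex; exists f => // a a' _ _ faa'.
by apply/val_inj/(Rinj _ _ (val (f a))) => //; [exact: set_valP|exact: set_valP|rewrite faa'].
Qed.

Lemma card_eq_rel T U (A : set T) (B : set U) (R : T -> U -> Prop) :
  (forall a, A a -> exists2 b, B b & R a b) ->
  (forall b, B b -> exists2 a, A a & R a b) ->
  (forall a a' b, A a -> A a' -> R a b -> R a' b -> a = a') ->
  (forall a b b', A a -> R a b -> R a b' -> b = b') ->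
  A #= B.
Proof.
move=> RA RB Ri Rf; rewrite card_eq_le; apply/andP; split.
  exact: (card_le_rel RA).
apply: (card_le_rel (R := fun b a => A a /\ R a b)) => [b /RB[a Aa]|b b' a _ _ [Aa]].
  by exists a.
by move=> Rab [_ Rab']; exact: Rf Rab Rab'.
Qed.

Lemma card_le_fun T U (A : set T) (B : set U) : B !=set0 -> A #<= B ->
  exists2 f : T -> U, (forall a, A a -> B (f a)) &
    (forall a a', A a -> A a' -> f a = f a' -> a = a').
Proof.
move=> [b Bb] /card_leP[f].
(* The default [b] outside [A] makes the map total on [T]. *)
exists (fun x => if pselect (A x) is left Ax
                 then val (f (SigSub (mem_set Ax))) else b) => [a Aa|a a' Aa Aa'].
  by case: pselect => // Aa'; exact: set_valP.
case: pselect => // Ca; case: pselect => // Ca' /val_inj.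
by move/(@inj _ _ _ f); rewrite !in_setT => /(_ isT isT) [].
Qed.

Lemma card_eq_fun T U (A : set T) (B : set U) : B !=set0 -> A #= B ->
  exists f : T -> U, [/\ (forall a, A a -> B (f a)),
    (forall a a', A a -> A a' -> f a = f a' -> a = a') &
    (forall b, B b -> exists2 a, A a & f a = b)].
Proof.
move=> [b Bb] /card_eqP[f].
exists (fun x => if pselect (A x) is left Ax
                 then val (f (SigSub (mem_set Ax))) else b); split=> [a Aa|a a' Aa Aa'|y By].
- by case: pselect => // Aa'; exact: set_valP.
- case: pselect => // Ca; case: pselect => // Ca' /val_inj.
  by move/(@inj _ _ _ f); rewrite !in_setT => /(_ isT isT) [].
- have [x _ fx] := @surj _ _ _ _ f (SigSub (mem_set By)) I.
  exists (val x); first exact: set_valP.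
  case: pselect => [Ax|/(_ (set_valP x))//].
  have -> : SigSub (mem_set Ax) = x by apply: val_inj.
  by rewrite fx.
Qed.

(** Zorn's lemma on graphs of partial injections: a maximal graph has full domain or full range,
    since otherwise one more pair could be added. *)
Lemma card_le_total T U (A : set T) (B : set U) : A #<= B \/ B #<= A.
Proof.
pose P (G : set (T * U)) := [/\ (forall a b, G (a, b) -> A a /\ B b),
  (forall a b b', G (a, b) -> G (a, b') -> b = b') &
  (forall a a' b, G (a, b) -> G (a', b) -> a = a')].
have [F FP Ftot|G [[GAB Gf Gi] Gmax]] := @Zorn_bigcup _ P.
  have join p q : (\bigcup_(X in F) X) p -> (\bigcup_(X in F) X) q ->
      exists2 X, F X & X p /\ X q.
    move=> [X FX Xp] [Y FY Yq]; have [XY|YX] := Ftot _ _ FX FY.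
    - by exists Y => //; split=> //; exact: XY.
    - by exists X => //; split=> //; exact: YX.
  split=> [a b [X /FP[+ _ _]]|a b b' Gab Gab'|a a' b Gab Gab'].
  - exact.
  - by have [X /FP[_ + _] [Xab]] := join _ _ Gab Gab'; apply; exact: Xab.
  - by have [X /FP[_ _ +] [Xab]] := join _ _ Gab Gab'; apply; exact: Xab.
have [Adom|/existsNP[a /not_implyP[Aa aG]]] :=
    pselect (forall a, A a -> exists b, G (a, b)).
  left; apply: (card_le_rel (R := fun a b => G (a, b))) => [a /Adom[b Gab]|a a' b _ _].
    by exists b => //; have [] := GAB _ _ Gab.
  exact: Gi.
have [Bran|/existsNP[b /not_implyP[Bb bG]]] :=
    pselect (forall b, B b -> exists a, G (a, b)).
  right; apply: (card_le_rel (R := fun b a => G (a, b))) => [b /Bran[a' Gab]|b b' a' _ _].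
    by exists a' => //; have [] := GAB _ _ Gab.
  exact: Gf.
have [] := Gmax (G `|` [set (a, b)]).
  split; first by move=> x Gx; left.
  by move=> /(_ (a, b) (or_intror erefl)) Gab; apply: aG; exists b.
split=> [x y [/GAB//|[-> ->]//]|x y y' [Gxy|[-> ->]] [Gxy'|]|x x' y [Gxy|[-> ->]] [Gxy'|]].
- exact: Gf Gxy Gxy'.
- by move=> [xa _]; case: aG; exists y; rewrite -xa.
- by case: aG; exists y'.
- by move=> [->].
- exact: Gi Gxy Gxy'.
- by move=> [_ yb]; case: bG; exists x; rewrite -yb.
- by case: bG; exists x'.
- by move=> [->].
Qed.

(** * Squares of infinite cardinals *)

Let partial_pairing T (A : set T) (p : set T * (T * T -> T)) := [/\ p.1 `<=` A,
  (forall u v, p.1 u -> p.1 v -> p.1 (p.2 (u, v))),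
  (forall u v u' v', p.1 u -> p.1 v -> p.1 u' -> p.1 v' ->
     p.2 (u, v) = p.2 (u', v') -> (u, v) = (u', v')) &
  infinite_set p.1].

(** The values of [p.2] outside the square of [p.1] are arbitrary, so this is only a preorder. *)
Let extends T (p q : set T * (T * T -> T)) :=
  p.1 `<=` q.1 /\ forall u v, p.1 u -> p.1 v -> p.2 (u, v) = q.2 (u, v).

(** A countably infinite subset of [A] inherits the coding of pairs of natural numbers. *)
Let partial_pairing_ex T (A : set T) : infinite_set A ->
  exists p, partial_pairing A p.
Proof.
move=> Ainf; have [i iA ii] := card_le_fun (infinite_setN0 Ainf) ((infiniteP A).1 Ainf).
have /choice[j jP] (x : T) : exists n, (exists m, x = i m) -> x = i n.
  by have [[n ->]|nx] := pselect (exists m, x = i m); [exists n|exists 0%N => /nx].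
have jK n : j (i n) = n by apply: ii => //; rewrite -jP//; exists n.
exists (range i, fun u => i (pickle (j u.1, j u.2))); split=> /=.
- by move=> _ [n _ <-]; exact: iA.
- by move=> u v _ _; exists (pickle (j u, j v)).
- move=> _ _ _ _ [n _ <-] [m _ <-] [n' _ <-] [m' _ <-].
  rewrite !jK => /ii-/(_ I I) /(pcan_inj (@pickleK (nat * nat)%type)).
  by move=> [-> ->].
- apply/infiniteP; apply: (card_le_rel (R := fun n x => x = i n)) => [n _|n m x _ _ ->].
    by exists (i n) => //; exists n.
  exact: ii.
Qed.

Let partial_pairing_ub T (A : set T) (S : set (set T * (T * T -> T))) :
  S !=set0 -> S `<=` partial_pairing A -> total_on S (@extends T) ->
  exists2 p, partial_pairing A p & forall q, S q -> extends q p.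
Proof.
move=> [p0 Sp0] SA Stot; pose X := \bigcup_(p in S) p.1.
(* Members of the chain agree where both are defined, so they glue; [w.1] is a default for pairs
   outside every square. *)
have /choice[f fP] (w : T * T) : exists t, forall p, S p -> p.1 w.1 -> p.1 w.2 ->
    t = p.2 w.
  have [[p [Sp p1 p2]]|np] := pselect (exists p, [/\ S p, p.1 w.1 & p.1 w.2]).
    exists (p.2 w) => q Sq q1 q2; case: w p1 p2 q1 q2 => u v /= p1 p2 q1 q2.
    by have [[_ pq]|[_ qp]] := Stot _ _ Sp Sq; [exact: pq|exact/esym/qp].
  by exists w.1 => p Sp p1 p2; case: np; exists p.
have join p q : S p -> S q -> exists2 r, S r & p.1 `<=` r.1 /\ q.1 `<=` r.1.
  move=> Sp Sq; have [[pq _]|[qp _]] := Stot _ _ Sp Sq.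
  - by exists q => //; split.
  - by exists p => //; split.
exists (X, f); last first.
  by move=> q Sq; split=> [x qx|u v qu qv /=]; [exists q|rewrite (fP _ q)].
split=> /=.
- by move=> x [p /SA[pA _ _ _] /pA].
- move=> u v [p Sp pu] [q Sq qv]; have [r Sr [pr qr]] := join _ _ Sp Sq.
  exists r => //; have [_ rf _ _] := SA _ Sr.
  by rewrite (fP (u, v) r)//=; [apply: rf; [exact: pr|exact: qr]|exact: pr|exact: qr].
- move=> u v u' v' [p Sp pu] [q Sq qv] [p' Sp' pu'] [q' Sq' qv'].
  have [r Sr [pr qr]] := join _ _ Sp Sq; have [r' Sr' [pr' qr']] := join _ _ Sp' Sq'.
  have [s Ss [rs r's]] := join _ _ Sr Sr'; have [_ _ si _] := SA _ Ss.
  move: pu qv pu' qv' => /pr/rs su /qr/rs sv /pr'/r's su' /qr'/r's sv'.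
  by rewrite (fP (u, v) s)// (fP (u', v') s)//; exact: si.
- have [_ _ _] := SA _ Sp0; apply: sub_infinite_set => x px; by exists p0.
Qed.

(* If [p.1] embeds into its complement in [A] via [h], the three missing
   rectangles of the square of [p.1 `|` h @` p.1] are coded inside [h @` p.1],
   each tagged by its own element of [p.1]. *)
Let partial_pairing_extend T (A : set T) p : partial_pairing A p ->
  p.1 #<= A `\` p.1 -> exists2 q, partial_pairing A q & extends p q /\ ~ extends q p.
Proof.
case: p => X f [/= XA Xf Xi Xinf] XAX.
have [x0 Xx0] := infinite_setN0 Xinf.
have [h hA hi] := card_le_fun (infinite_setN0 (fun fA => Xinf (card_le_finite XAX fA))) XAX.
have [i iX ii] := card_le_fun (infinite_setN0 Xinf) ((infiniteP X).1 Xinf).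
have hX x : X x -> ~ X (h x) by move=> /hA[].
pose Y := X `|` h @` X.
(* [r] leads a point of [Y] back to [X]: to the point itself or to its preimage under [h]. *)
have /choice[r rP] (x : T) : exists x', Y x -> X x' /\ (if x \in X then x = x' else x = h x').
  have [Xx|nXx] := boolP (x \in X); first by exists x => _; split=> //; exact: set_mem.
  have [[x' Xx' <-]|nx] := pselect ((h @` X) x); first by exists x'.
  by exists x0 => -[/mem_set|//]; rewrite (negPf nXx).
(* The argument of [i] is 0, 1 or 2 on the new rectangles and 3 on the old square, where [g] keeps
   [f]. *)
pose t u v := i ((u \in X) + (v \in X).*2)%N.
pose g (w : T * T) := if (w.1 \in X) && (w.2 \in X) then f w
  else h (f (t w.1 w.2, f (r w.1, r w.2))).
have tX u v : X (t u v) by exact: iX.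
exists (Y, g).
  split=> /=.
  - by move=> x [/XA//|[x' /hA[? _] <-]].
  - move=> u v Yu Yv; rewrite /g /=; case: ifPn => [/andP[/set_mem Xu /set_mem Xv]|_].
      by left; exact: Xf.
    right; exists (f (t u v, f (r u, r v))) => //; apply: (Xf) => //.
    by apply: Xf; [have [] := rP _ Yu|have [] := rP _ Yv].
  - move=> u v u' v' Yu Yv Yu' Yv'; rewrite /g /=.
    have [Ru ru] := rP _ Yu; have [Rv rv] := rP _ Yv.
    have [Ru' ru'] := rP _ Yu'; have [Rv' rv'] := rP _ Yv'.
    have Fr : X (f (r u, r v)) by exact: Xf.
    have Fr' : X (f (r u', r v')) by exact: Xf.
    case: ifPn => [/andP[/set_mem Xu /set_mem Xv]|_];
      case: ifPn => [/andP[/set_mem Xu' /set_mem Xv']|_].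
    + exact: Xi.
    + move=> E; case: (hX (f (t u' v', f (r u', r v')))); first exact: Xf.
      by rewrite -E; exact: Xf.
    + move=> E; case: (hX (f (t u v, f (r u, r v)))); first exact: Xf.
      by rewrite E; exact: Xf.
    (* Equal codes have equal tags, which tell which coordinates lie in [X], and equal base points,
       which then determine the pair. *)
    move/hi => /(_ (Xf _ _ (tX _ _) Fr) (Xf _ _ (tX _ _) Fr')).
    move=> /Xi-/(_ (tX _ _) Fr (tX _ _) Fr')[/ii-/(_ I I)] E.
    move=> /Xi-/(_ Ru Rv Ru' Rv')[Eu Ev].
    by move: E ru rv ru' rv'; rewrite Eu Ev; do 4!case: (_ \in X) => //=;
      move=> _ -> -> <- <-.
  - by apply: sub_infinite_set Xinf => x; left.
split; first split=> /=; first by move=> x; left.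
  by move=> u v /mem_set Xu /mem_set Xv; rewrite /g /= Xu Xv.
by move=> [/= YX _]; apply: (hX _ Xx0); apply: YX; right; exists x0.
Qed.

Lemma card_le_setX_inj T (X : set T) (f : T * T -> T) :
  (forall u v, X u -> X v -> X (f (u, v))) ->
  (forall u v u' v', X u -> X v -> X u' -> X v' ->
     f (u, v) = f (u', v') -> (u, v) = (u', v')) ->
  X `*` X #<= X.
Proof.
move=> Xf Xi; apply: (card_le_rel (R := fun u x => x = f u)).
  by move=> [u v] [/= Xu Xv]; exists (f (u, v)) => //; exact: Xf.
by move=> [u v] [u' v'] x [/= ? ?] [/= ? ?] -> /Xi; exact.
Qed.

Lemma card_le_setX T1 T2 U1 U2 (A : set T1) (B : set T2) (C : set U1) (D : set U2) :
  A #<= C -> B #<= D -> A `*` B #<= C `*` D.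
Proof.
move=> AC BD; have [C0|/set0P C0] := eqVneq C set0.
  have A0 : A = set0 by apply/(card_le0P U1); rewrite -C0.
  by rewrite A0 set0X; exact: card_ge0.
have [D0|/set0P D0] := eqVneq D set0.
  have B0 : B = set0 by apply/(card_le0P U2); rewrite -D0.
  by rewrite B0 setX0; exact: card_ge0.
have [f fC fi] := card_le_fun C0 AC; have [g gD gi] := card_le_fun D0 BD.
apply: (card_le_rel (R := fun x y => y = (f x.1, g x.2))).
  by move=> [a b] [/= Aa Bb]; exists (f a, g b) => //; split; [exact: fC|exact: gD].
move=> [a b] [a' b'] y [/= Aa Bb] [/= Aa' Bb'] -> [faa' gbb'].
by rewrite (fi _ _ Aa Aa' faa') (gi _ _ Bb Bb' gbb').
Qed.

(** If the domain of a maximal pairing embedded into the rest of [A], the pairing could be extended.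
    So the rest embeds into the domain, and [A] has the size of a set that contains a copy of its
    own square. *)
Theorem infinite_card_setX T (A : set T) : infinite_set A -> A `*` A #<= A.
Proof.
move=> Ainf; pose S := {p | partial_pairing A p}.
pose R (s t : S) := `[< extends (sval s) (sval t) >].
have [p0 Pp0] := partial_pairing_ex Ainf.
have [||F Ftot|[p Pp] pmax] := @ZL_preorder S (exist _ p0 Pp0) R.
- by move=> s; apply/asboolP; split.
- move=> r s t /asboolP[rs rs'] /asboolP[st st']; apply/asboolP; split.
    by move=> x /rs/st.
  by move=> u v ru rv; rewrite rs'// st'//; exact: rs.
- have [F0|/set0P F0] := eqVneq F set0.
    by exists (exist _ p0 Pp0) => s; rewrite F0.
  have [|||q Pq qub] := @partial_pairing_ub _ A (sval @` F).
  + by case: F0 => s Fs; exists (sval s), s.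
  + by move=> _ [s _ <-]; exact: svalP.
  + move=> _ _ [s Fs <-] [t Ft <-].
    by have [/asboolP|/asboolP] := Ftot _ _ Fs Ft; [left|right].
  by exists (exist _ q Pq) => s Fs; apply/asboolP/qub; exists s.
have [pA|/(partial_pairing_extend Pp)[q Pq [pq qp]]] := card_le_total (A `\` p.1) p.1.
  have [XA Xf Xi Xinf] := Pp.
  have [i iX ii] := card_le_fun (infinite_setN0 Xinf) ((infiniteP _).1 Xinf).
  have [h hX hi] := card_le_fun (infinite_setN0 Xinf) pA.
  have AX : A #<= p.1.
    (* The tags [i 0] and [i 1] separate the points of the domain from the others. *)
    apply: (card_le_rel (R := fun a x => (p.1 a /\ x = p.2 (i 0%N, a)) \/
        (~ p.1 a /\ x = p.2 (i 1%N, h a)))).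
      move=> a Aa; have [pa|npa] := pselect (p.1 a).
        by exists (p.2 (i 0%N, a)); [apply: Xf => //; exact: iX|left].
      exists (p.2 (i 1%N, h a)); last by right.
      by apply: Xf; [exact: iX|exact: hX].
    move=> a a' x Aa Aa' [[pa ->]|[npa ->]] [[pa']|[npa']] /Xi.
    - by move=> /(_ (iX _ I) pa (iX _ I) pa')[].
    - by move=> /(_ (iX _ I) pa (iX _ I) (hX _ (conj Aa' npa')))[/ii-/(_ I I)].
    - by move=> /(_ (iX _ I) (hX _ (conj Aa npa)) (iX _ I) pa')[/ii-/(_ I I)].
    - by move=> /(_ (iX _ I) (hX _ (conj Aa npa)) (iX _ I) (hX _ (conj Aa' npa')))[]
         /hi; exact.
  apply: card_le_trans (card_le_setX AX AX) _.
  exact: card_le_trans (card_le_setX_inj Xf Xi) (subset_card_le XA).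
case: qp; have := pmax (exist _ q Pq); rewrite /R /= => /(_ _)/asboolP.
by apply; apply/asboolP.
Qed.

(** * Unions and differences under an infinite bound *)

Lemma infinite_card_setU T U (A B : set T) (C : set U) : infinite_set C ->
  A #<= C -> B #<= C -> A `|` B #<= C.
Proof.
move=> Cinf AC BC; have [i iC ii] := card_le_fun (infinite_setN0 Cinf) ((infiniteP _).1 Cinf).
apply: card_le_trans (infinite_card_setX Cinf).
have [f fC fi] := card_le_fun (infinite_setN0 Cinf) AC.
have [g gC gi] := card_le_fun (infinite_setN0 Cinf) BC.
apply: (card_le_rel (R := fun x y => (A x /\ y = (i 0%N, f x)) \/ (B x /\ y = (i 1%N, g x)))).
  move=> x [Ax|Bx].
    by exists (i 0%N, f x); [split; [exact: iC|exact: fC]|left].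
  by exists (i 1%N, g x); [split; [exact: iC|exact: gC]|right].
move=> x x' y _ _ [[Ax ->]|[Bx ->]] [[Ax' []]|[Bx' []]].
- by move/fi; exact.
- by move/ii => /(_ I I).
- by move/ii => /(_ I I).
- by move/gi; exact.
Qed.

Lemma infinite_card_bigcup I T U (D : set I) (F : I -> set T) (C : set U) :
  infinite_set C -> D #<= C -> (forall i, D i -> F i #<= C) ->
  \bigcup_(i in D) F i #<= C.
Proof.
move=> Cinf DC FC; apply: card_le_trans (infinite_card_setX Cinf).
have C0 := infinite_setN0 Cinf.
have [f fC fi] := card_le_fun C0 DC.
have /choice[g gP] (i : I) : exists g : T -> U, D i -> (forall x, F i x -> C (g x)) /\
    (forall x y, F i x -> F i y -> g x = g y -> x = y).
  have [Di|nDi] := pselect (D i); last by case: C0 => c _; exists (fun=> c) => /nDi.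
  by have [g gC gi] := card_le_fun C0 (FC i Di); exists g.
apply: (card_le_rel (R := fun x y => exists2 i, D i /\ F i x & y = (f i, g i x))).
  move=> x [i Di Fix]; exists (f i, g i x); last by exists i.
  by split; [exact: fC|exact: (gP i Di).1].
move=> x x' y _ _ [i [Di Fx] ->] [i' [Di' Fx'] [/(fi _ _ Di Di') ii' gg]].
by subst i'; exact: (gP i Di).2 gg.
Qed.

(** If [A] also failed to embed into [D], the larger of [B] and [D] would bound their union when
    infinite, and would force [A] to be finite otherwise. *)
Lemma infinite_card_setD T (A B D : set T) : infinite_set A -> ~ (A #<= B) ->
  A `<=` B `|` D -> A #<= D.
Proof.
move=> Ainf AB AD; apply/negP => /negP nAD.
have bound (C : set T) : B #<= C -> D #<= C -> C = B \/ C = D -> False.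
  move=> BC DC CBD; have AC : ~ (A #<= C) by case: CBD => -> //; exact/negP.
  have [Cfin|Cinf] := pselect (finite_set C).
    apply: Ainf; apply: sub_finite_set AD _.
    by rewrite finite_setU; split; [exact: card_le_finite BC Cfin|exact: card_le_finite DC Cfin].
  exact/AC/(card_le_trans (subset_card_le AD))/infinite_card_setU.
have [BD|DB] := card_le_total B D.
- by apply: (bound D) => //; right.
- by apply: (bound B) => //; left.
Qed.

Lemma infinite_card_setD1 T (A : set T) x : infinite_set A -> A `\ x #= A.
Proof.
move=> Ainf; rewrite card_eq_le; apply/andP; split; first exact: card_le_setD.
apply: (infinite_card_setD (B := [set x])) => //.
  by move/card_le_finite => /(_ (finite_set1 x)).
by move=> y Ay; have [->|yx] := pselect (y = x); [left|right].
Qed.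

Lemma infinite_card_setU1 T (A : set T) x : infinite_set A -> x |` A #= A.
Proof.
move=> Ainf; rewrite card_eq_le; apply/andP; split.
  apply: infinite_card_setU => //; apply: card_le_trans ((infiniteP A).1 Ainf).
  exact: countable1.
by apply: subset_card_le => y; right.
Qed.

End CardinalArithmetic.

(** * Unions of chains of small sets *)

Lemma card_image_inj T U (A : set T) (f : T -> U) :
  (forall x y, A x -> A y -> f x = f y -> x = y) -> f @` A #= A.
Proof. by move=> fi; apply: inj_card_eq => x y /set_mem Ax /set_mem Ay; exact: fi. Qed.

(* If [B], larger than [A], embedded into the union, no [F i] would contain its
   image, so the union would be covered by [B]-many members of the chain. *)
Lemma card_le_chain_union I T U V (F : I -> set T) (A : set U) (B : set V) :
  (forall i j, F i `<=` F j \/ F j `<=` F i) -> (forall i, F i #<= A) ->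
  infinite_set B -> A #<= B -> ~ (B #<= A) -> \bigcup_i F i #<= B.
Proof.
move=> Ftot FA Binf AB BA; have [//|BF] := card_le_total (\bigcup_i F i) B.
have [F0|/set0P F0] := eqVneq (\bigcup_i F i) set0; first by rewrite F0 card_ge0.
have [h hF hi] := card_le_fun F0 BF.
have [_ [i0 _ _]] := F0.
have /choice[x xP] (b : V) : exists i, B b -> F i (h b).
  by have [/hF[i _ Fi]|nb] := pselect (B b); [exists i|exists i0].
apply: (@card_le_trans _ _ _ (\bigcup_(b in B) F (x b))).
  apply/subset_card_le => k [i _ Fik].
  have [b Bb nFb] : exists2 b, B b & ~ F i (h b).
    apply: contrapT => /forall2NP nb; apply/BA/(card_le_trans _ (FA i)).
    apply: (card_le_rel (R := fun b k => k = h b)) => [b Bb|b b' y Bb Bb' ->].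
      by exists (h b) => //; case: (nb b) => // /contrapT.
    exact: hi.
  exists b => //; have [Fx|Fx] := Ftot i (x b); first exact: Fx.
  by case: nFb; apply: Fx; exact: xP.
apply: infinite_card_bigcup => // b _.
exact: card_le_trans (FA _) AB.
Qed.

(** Every cardinal above [A] bounds the union of the chain, hence [V]; so [V], read as a type, is
    the least cardinal above [A]. *)
Lemma is_succ_cardinal_chain I T (F : I -> set T) (A : Type) (V : set T) :
  infinite_set [set: A] ->
  (forall i j, F i `<=` F j \/ F j `<=` F i) -> (forall i, F i #<= [set: A]) ->
  V `<=` \bigcup_i F i -> ~ (V #<= [set: A]) -> is_succ_cardinal A V.
Proof.
move=> Ainf Ftot FA VF VA; split.
  split; last by rewrite (card_le_eql (card_setT V)).
  by rewrite (card_le_eqr (card_setT V)); case: (card_le_total [set: A] V).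
move=> B [AB BA]; rewrite (card_le_eql (card_setT V)).
apply: card_le_trans (subset_card_le VF) _.
have Binf : infinite_set [set: B] by move=> Bfin; exact: Ainf (card_le_finite AB Bfin).
exact: card_le_chain_union FA Binf AB BA.
Qed.

(** * The weight as a number of jumps *)

Section Weight.
Context {d : Order.disp_t} {L : orderType d}.
Implicit Types (a c e x y : L) (X D : set L).

Definition jump c e := c < e /\ [set x | c < x < e] = set0.

Lemma jump_le c e x : jump c e -> x < e -> x <= c.
Proof.
move=> [_ ce0] xe; rewrite leNgt; apply/negP => cx.
suff : [set x | c < x < e] x by rewrite ce0.
by rewrite /= cx.
Qed.

Lemma jump_ge c e x : jump c e -> c < x -> e <= x.
Proof. by move=> ce cx; rewrite leNgt; apply/negP => /(jump_le ce); rewrite leNgt cx. Qed.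

(** A right endpoint determines its jump, so this set counts the jumps inside [X]. *)
Definition jump_ends X := [set e | X e /\ exists2 c, X c & jump c e].

Definition order_convex X := forall x y z, X x -> X y -> x <= z <= y -> X z.

Lemma weakly_dense_jump_ends X : dense_jumps L -> order_convex X ->
  weakly_dense X (jump_ends X).
Proof.
move=> Lj Xc; split=> [x []//|x y Xx Xy /Lj[c [e [xc ce ey ce0]]]].
have xe : x <= e := le_trans xc (ltW ce).
exists e; last by rewrite xe.
split; first by apply: Xc Xx Xy _; rewrite xe.
by exists c => //; apply: Xc Xx Xy _; rewrite xc (le_trans (ltW ce)).
Qed.

(* A weakly dense set contains an endpoint of each jump, and each point is an
   endpoint of at most two jumps. *)
Lemma jump_ends_card_le X D : weakly_dense X D -> infinite_set (jump_ends X) ->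
  jump_ends X #<= D.
Proof.
move=> [DX Dd] Jinf.
(* The flag tells whether the point of [D] is the right ([true]) or the left endpoint of the
   jump. *)
pose R e (p : L * bool) := exists2 c, jump c e & p = (e, true) \/ p = (c, false).
have JD : jump_ends X #<= D `*` [set: bool].
  apply: (card_le_rel (R := R)) => [e [Xe [c Xc ce]]|e e' [z b] _ _ [c ce zb] [c' ce' zb']].
    have [z Dz /andP[cz ze]] := Dd _ _ Xc Xe ce.1.
    move: ze; rewrite le_eqVlt => /orP[/eqP ze|/(jump_le ce) zc].
      by exists (e, true); [split=> //=; rewrite -ze|exists c => //; left].
    have {zc}cz : c = z by apply/eqP; rewrite eq_le cz.
    by exists (c, false); [split=> //=; rewrite cz|exists c => //; right].
  case: zb zb' => -[-> ->] [] [] // E.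
  move: ce'; rewrite -E => ce'; apply/eqP.
  by rewrite eq_le (jump_ge ce ce'.1) (jump_ge ce' ce.1).
have Dinf : infinite_set D.
  move=> Dfin; apply: Jinf; apply: card_le_finite JD _.
  by apply: finite_setX => //; exact: finite_finset.
apply: card_le_trans JD _; apply: card_le_trans (infinite_card_setX Dinf).
apply: card_le_setX; first exact: card_lexx.
apply: card_le_trans ((infiniteP D).1 Dinf); exact: countableP.
Qed.

(** The jump ends attain the minimum: they are weakly dense and, when infinite, no more numerous
    than any weakly dense set. *)
Lemma has_weightE X W : dense_jumps L -> order_convex X -> infinite_set [set: W] ->
  has_weight X W <-> jump_ends X #= [set: W].
Proof.
move=> Lj Xc Winf; have Jd := weakly_dense_jump_ends Lj Xc.
have inf : [set: W] #<= jump_ends X -> infinite_set (jump_ends X).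
  by move=> WJ Jfin; exact: Winf (card_le_finite WJ Jfin).
split=> [[[D Dd DW] Wmin]|JW].
  have WJ := Wmin _ Jd; rewrite card_eq_le WJ andbT -(card_le_eqr DW).
  exact: jump_ends_card_le (inf WJ).
have WJ : [set: W] #<= jump_ends X by move: JW; rewrite card_eq_le => /andP[].
split; first by exists (jump_ends X).
by move=> D Dd; apply: (card_le_trans WJ); exact: jump_ends_card_le (inf WJ).
Qed.

Lemma jump_ends_lower a :
  jump_ends (lower_ray a) = [set e | jump_ends setT e /\ e <= a].
Proof.
apply/seteqP; split=> e.
  by move=> [ea [c _ ce]]; split=> //; split=> //; exists c.
move=> [[_ [c _ ce]] ea]; split=> //; exists c => //.
exact: le_trans (ltW ce.1) ea.
Qed.

(** The inequality is strict because [a], the least point of the ray, ends no jump within it. *)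
Lemma jump_ends_upper a :
  jump_ends (upper_ray a) = [set e | jump_ends setT e /\ a < e].
Proof.
apply/seteqP; split=> e.
  move=> [_ [c ac ce]]; split; last exact: le_lt_trans ac ce.1.
  by split=> //; exists c.
move=> [[_ [c _ ce]] ea]; split; first exact: ltW.
by exists c => //; exact: jump_le ea.
Qed.

Lemma has_weight_lower a W : dense_jumps L -> infinite_set [set: W] ->
  has_weight (lower_ray a) W <-> [set e | jump_ends setT e /\ e <= a] #= [set: W].
Proof.
move=> Lj Winf; rewrite -jump_ends_lower; apply: has_weightE => //.
by move=> x y z _ ya /andP[_ zy]; exact: le_trans zy ya.
Qed.

Lemma has_weight_upper a W : dense_jumps L -> infinite_set [set: W] ->
  has_weight (upper_ray a) W <-> [set e | jump_ends setT e /\ a < e] #= [set: W].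
Proof.
move=> Lj Winf; rewrite -jump_ends_upper; apply: has_weightE => //.
by move=> x y z ax _ /andP[xz _]; exact: le_trans ax xz.
Qed.

End Weight.

(** * Jumps of a maximal chain *)

Section MaximalChain.
Context {d : Order.disp_t} {L : orderType d} {K N M : Type}.
Hypotheses (N_infinite : infinite_set [set: N]) (M_infinite : infinite_set [set: M]).
Variable f : L -> set K.
Hypothesis f_maximal : maximal_chain (split_subsets K N M) (range f).
Hypothesis f_le : forall x y, x <= y <-> f x `<=` f y.

Let P := split_subsets K N M.
Let I := \bigcap_x f x.
Let U := \bigcup_x f x.

Lemma chain_split x : P (f x).
Proof. by case: f_maximal => fP _ _; apply: fP; exists x. Qed.

Lemma chain_lt x y : x < y -> exists2 k, f y k & ~ f x k.
Proof.
move=> xy; apply: contrapT => /forall2NP nk; move: xy; rewrite ltNge => /negP; apply.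
by apply/f_le => k fk; case: (nk k) => // /contrapT.
Qed.

(** Maximality in usable form: adding [Z] leaves a chain in [P], so [Z] was already a member. *)
Lemma chain_maximal Z : P Z -> (forall x, Z `<=` f x \/ f x `<=` Z) -> exists z, f z = Z.
Proof.
case: f_maximal => fP ftot fmax PZ Zf.
have : range f `|` [set Z] = range f.
  apply: fmax => [X [/fP//|->//]|_ _ [[x _ <-]|->] [[y _ <-]|->]|X fX].
  - by apply: ftot; [exists x|exists y].
  - by case: (Zf x); [right|left].
  - exact: Zf.
  - by left.
  - by left.
move=> E; have [z _ fz] : range f Z by rewrite -E; right.
by exists z.
Qed.

Lemma chain_split_between x y Z : f x `<=` Z -> Z `<=` f y -> P Z.
Proof.
move=> xZ Zy; have [fxN fxM] := chain_split x; have [fyN fyM] := chain_split y.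
split; rewrite card_eq_le; apply/andP; split.
- by rewrite -(card_le_eqr fyN); exact: subset_card_le.
- by rewrite -(card_le_eql fxN); exact: subset_card_le.
- by rewrite -(card_le_eqr fxM); apply/subset_card_le/subsetC.
- by rewrite -(card_le_eql fyM); apply/subset_card_le/subsetC.
Qed.

Lemma split_subsets_setU1 Z k : P Z -> P (k |` Z).
Proof.
move=> [ZN ZM]; split.
  apply: (card_eq_trans _ ZN); apply: infinite_card_setU1.
  by rewrite (eq_finite_set ZN).
have -> : ~` (k |` Z) = ~` Z `\ k by rewrite setCU setIC.
apply: (card_eq_trans _ ZM); apply: infinite_card_setD1.
by rewrite (eq_finite_set ZM).
Qed.

Lemma split_subsets_setD1 Z k : P Z -> P (Z `\ k).
Proof.
move=> [ZN ZM]; split.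
  apply: (card_eq_trans _ ZN); apply: infinite_card_setD1.
  by rewrite (eq_finite_set ZN).
have -> : ~` (Z `\ k) = k |` ~` Z by rewrite setCI setCK setUC.
apply: (card_eq_trans _ ZM); apply: infinite_card_setU1.
by rewrite (eq_finite_set ZM).
Qed.

(** Were [I] in the poset, so would be [I] without one of its points; lying below the whole chain,
    this set would be a member that does not contain [I]. *)
Lemma chain_inter_nsplit : ~ P I.
Proof.
move=> PI; have [k Ik] : I !=set0.
  by apply: infinite_setN0; rewrite (eq_finite_set PI.1).
have [z fz] : exists z, f z = I `\ k.
  apply: chain_maximal; first exact: split_subsets_setD1.
  by move=> x; left => y [Iy _]; exact: Iy.
suff [_] : (I `\ k) k by apply.
by rewrite -fz; exact: Ik.
Qed.

Lemma chain_union_nsplit : ~ P U.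
Proof.
move=> PU; have [k nUk] : ~` U !=set0.
  by apply: infinite_setN0; rewrite (eq_finite_set PU.2).
have [z fz] : exists z, f z = k |` U.
  apply: chain_maximal; first exact: split_subsets_setU1.
  by move=> x; right => y fy; right; exists x.
by apply: nUk; exists z => //; rewrite fz; left.
Qed.

(** This relation matches a jump with the point it adds; it is the bijection behind both counts of
    jumps below. *)
Let first_in k e := f e k /\ forall x, x < e -> ~ f x k.

Let first_in_inj k e e' : first_in k e -> first_in k e' -> e = e'.
Proof.
move=> [ek emin] [e'k e'min]; case: (ltgtP e e') => // lt.
- by case: (e'min _ lt).
- by case: (emin _ lt).
Qed.

(** A jump adds a single point: [f c] with [k] added is comparable with every member, hence is a
    member, and being above [f c] it contains [f e]. *)
Let first_in_fun k k' e : jump_ends setT e -> first_in k e -> first_in k' e -> k = k'.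
Proof.
move=> [_ [c _ ce]] [ek emin] [ek' emin'].
have nck : ~ f c k := emin _ ce.1.
have cxe x : c < x -> f e `<=` f x by move=> /(jump_ge ce)/f_le.
have [z fz] : exists z, f z = k |` f c.
  apply: chain_maximal; first exact/split_subsets_setU1/chain_split.
  move=> x; have [xc|cx] := leP x c; first by right=> j /((f_le _ _).1 xc); right.
  by left=> j [->|/((f_le _ _).1 (ltW cx))//]; exact: cxe ek.
have cz : c < z.
  rewrite ltNge; apply/negP => /f_le zc; apply: nck; apply: zc.
  by rewrite fz; left.
have := cxe _ cz _ ek'; rewrite fz => -[//|ck'].
by case: (emin' _ ce.1).
Qed.

(** The jump at which [k] enters runs from the union of the members without [k] to the intersection
    of those with [k]; both belong to the chain by maximality. *)
Let first_in_jump k : U k -> ~ I k -> exists2 e, jump_ends setT e & first_in k e.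
Proof.
move=> [b _ bk] nIk.
have [a nak] : exists a, ~ f a k.
  by apply: contrapT => /forallNP ak; apply: nIk => x _; exact: contrapT (ak x).
have mono x y : f x k -> ~ f y k -> f y `<=` f x.
  move=> xk nyk; apply/f_le/ltW; rewrite ltNge; apply/negP => /f_le xy.
  exact/nyk/xy.
have [c fc] : exists c, f c = \bigcup_(x in [set x | ~ f x k]) f x.
  apply: chain_maximal => [|x].
    apply: (@chain_split_between a b); first by move=> j fj; exists a.
    by move=> j [x nxk]; exact: mono.
  have [xk|nxk] := pselect (f x k); last by right => j fj; exists x.
  by left => j [y nyk]; exact: mono.
have [e fe] : exists e, f e = \bigcap_(x in [set x | f x k]) f x.
  apply: chain_maximal => [|x].
    apply: (@chain_split_between a b); last by move=> j; exact.
    by move=> j fj x xk; exact: mono fj.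
  have [xk|nxk] := pselect (f x k); first by left => j; exact.
  by right => j fj y yk; exact: mono fj.
have nck : ~ f c k by rewrite fc => -[].
have ek : f e k by rewrite fe => x.
have le_c x : ~ f x k -> x <= c by move=> nxk; apply/f_le; rewrite fc => j fj; exists x.
have e_le x : f x k -> e <= x by move=> xk; apply/f_le; rewrite fe => j; exact.
exists e; last by split=> // x xe xk; move: xe; rewrite ltNge e_le.
split=> //; exists c => //; split.
  by rewrite ltNge; apply/negP => /f_le/(_ k ek).
apply/seteqP; split=> // x /= /andP[cx xe].
have [/e_le|/le_c] := pselect (f x k); first by rewrite leNgt xe.
by rewrite leNgt cx.
Qed.

(** Suprema are unions. Between [a] and [b] lies the jump at which a point of [f b] outside [f a]
    enters. *)
Lemma chain_weakly_boolean : weakly_boolean L.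
Proof.
split=> [A [a Aa] [b Ab]|a b ab].
  have [s fs] : exists s, f s = \bigcup_(x in A) f x.
    apply: chain_maximal => [|x].
      apply: (@chain_split_between a b); first by move=> k fk; exists a.
      by move=> k [x /Ab/f_le xb /xb].
    have [xA|/existsNP[y /not_implyP[Ay /negP yx]]] :=
        pselect (forall y, A y -> y <= x).
      by left => k [y /xA/f_le yx /yx].
    right => k fk; exists y => //.
    by move: k fk; apply/f_le/ltW; rewrite ltNge.
  exists s; split=> [x Ax|u uA]; apply/f_le; rewrite fs.
    by move=> k fk; exists x.
  by move=> k [x /uA/f_le xu /xu].
have [k bk nak] := chain_lt ab.
have [||e [_ [c _ ce]] [ek emin]] := @first_in_jump k; first by exists b.
  by move=> Ik; exact/nak/Ik.
have ae : a < e by rewrite ltNge; apply/negP => /f_le/(_ _ ek).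
exists c, e; split; [exact: jump_le ae|exact: ce.1| |exact: ce.2].
by rewrite leNgt; apply/negP => /emin.
Qed.

Let first_in_le k e x : first_in k e -> e <= x <-> f x k.
Proof.
move=> [ek emin]; split=> [/f_le/(_ _ ek)//|xk].
by rewrite leNgt; apply/negP => /emin.
Qed.

Let jump_first_in e : jump_ends setT e -> exists k, first_in k e.
Proof.
move=> [_ [c _ ce]]; have [k ek nck] := chain_lt ce.1.
exists k; split=> // x /(jump_le ce)/f_le xc /xc; exact: nck.
Qed.

Lemma card_jumps_lower a : [set e | jump_ends setT e /\ e <= a] #= f a `\` I.
Proof.
apply: (card_eq_rel (R := fun e k => first_in k e)).
- move=> e [Je ea]; have [k ke] := jump_first_in Je; exists k => //.
  split; first exact/(first_in_le _ ke).
  case: Je => [_ [c _ ce]] Ik; case: ke => _ /(_ _ ce.1); apply; exact: Ik.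
- move=> k [ak nIk]; have [|//|e Je ke] := @first_in_jump k; first by exists a.
  by exists e => //; split=> //; exact/(first_in_le _ ke).
- by move=> e e' k _ _; exact: first_in_inj.
- by move=> e k k' [Je _]; exact: first_in_fun.
Qed.

Lemma card_jumps_upper a : [set e | jump_ends setT e /\ a < e] #= U `\` f a.
Proof.
apply: (card_eq_rel (R := fun e k => first_in k e)).
- move=> e [Je ae]; have [k ke] := jump_first_in Je; exists k => //.
  by split; [exists e => //; exact: ke.1|exact: ke.2].
- move=> k [Uk nak]; have [//|  |e Je ke] := @first_in_jump k; first by move=> Ik; exact/nak/Ik.
  exists e => //; split=> //; rewrite ltNge; apply/negP => /(first_in_le _ ke).
  exact: nak.
- by move=> e e' k _ _; exact: first_in_inj.
- by move=> e k k' [Je _]; exact: first_in_fun.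
Qed.

(** If [f a] embedded into [I], then [I] would be in the poset, as its complement is bounded by [K]
    and so by [M]. Hence the difference carries the size of [f a]. *)
Lemma card_lower_full : [set: K] #<= [set: M] -> forall a, f a `\` I #= [set: N].
Proof.
move=> KM a; have [faN faM] := chain_split a.
rewrite -(card_eqr faN) card_eq_le; apply/andP; split; first exact: card_le_setD.
apply: (infinite_card_setD (B := I)); first by rewrite (eq_finite_set faN).
  move=> aI; apply: chain_inter_nsplit; split; rewrite card_eq_le; apply/andP; split.
  - by rewrite -(card_le_eqr faN); apply: subset_card_le => k; exact.
  - by rewrite -(card_le_eql faN).
  - exact: card_le_trans (card_leT _) KM.
  - by rewrite -(card_le_eql faM); apply: subset_card_le => k nk Ik; exact/nk/Ik.
by move=> k fk; have [Ik|nIk] := pselect (I k); [left|right].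
Qed.

Lemma card_upper_full : [set: K] #<= [set: N] -> forall a, U `\` f a #= [set: M].
Proof.
move=> KN a; have [faN faM] := chain_split a.
rewrite -(card_eqr faM) card_eq_le; apply/andP; split.
  by apply: subset_card_le => k [].
apply: (infinite_card_setD (B := ~` U)); first by rewrite (eq_finite_set faM).
  move=> aU; apply: chain_union_nsplit; split; rewrite card_eq_le; apply/andP; split.
  - exact: card_le_trans (card_leT _) KN.
  - by rewrite -(card_le_eql faN); apply: subset_card_le => k fk; exists a.
  - by rewrite -(card_le_eqr faM); apply: subset_card_le => k nUk fk; apply: nUk; exists a.
  - by rewrite -(card_le_eql faM).
by move=> k fk; have [Uk|nUk] := pselect (U k); [right|left].
Qed.

Let chain_total x y : f x `<=` f y \/ f y `<=` f x.
Proof. by case/orP: (le_total x y) => /f_le; [left|right]. Qed.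

(** If [U] had size at most [N], its complement would have the size of [K], which is that of [M],
    and [U] would be in the poset. So the part outside [f a] exceeds [N], while a chain of sets of
    size [N] covers it. *)
Lemma card_upper_succ : [set: K] #<= [set: M] -> ~ ([set: K] #<= [set: N]) ->
  forall a, is_succ_cardinal N (U `\` f a).
Proof.
move=> KM KN a; have [faN faM] := chain_split a.
apply: (is_succ_cardinal_chain (F := f)) => //.
  by move=> x; have [/card_eqPle[]] := chain_split x.
move=> UN; have UaN : U #<= [set: N].
  have faNle : f a #<= [set: N] by case/card_eqPle: faN.
  apply: card_le_trans (infinite_card_setU N_infinite faNle UN).
  by apply: subset_card_le => k Uk; have [ak|nak] := pselect (f a k); [left|right].
apply: chain_union_nsplit; split; rewrite card_eq_le; apply/andP; split => //.
- by rewrite -(card_le_eql faN); apply: subset_card_le => k fk; exists a.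
- exact: card_le_trans (card_leT _) KM.
have KMe : [set: K] #= [set: M].
  rewrite card_eq_le KM -(card_le_eql faM); exact: card_leT.
rewrite -(card_le_eql KMe); apply: (infinite_card_setD (B := U)).
- by rewrite (eq_finite_set KMe).
- by move=> KU; exact: KN (card_le_trans KU UaN).
- by rewrite setUv.
Qed.

(** Dual argument: the complements of the members form a chain of sets of size [M] that covers the
    complement of [I]. *)
Lemma card_lower_succ : [set: K] #<= [set: N] -> ~ ([set: K] #<= [set: M]) ->
  forall a, is_succ_cardinal M (f a `\` I).
Proof.
move=> KN KM a; have [faN faM] := chain_split a.
apply: (is_succ_cardinal_chain (F := fun x => ~` f x)) => //.
- by move=> x y; case: (chain_total x y) => /subsetC; [right|left].
- by move=> x; have [_ /card_eqPle[]] := chain_split x.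
- by move=> k [_ /existsNP[x /not_implyP[_ nxk]]]; exists x.
move=> aM; have IM : ~` I #<= [set: M].
  have faMle : ~` f a #<= [set: M] by case/card_eqPle: faM.
  apply: card_le_trans (infinite_card_setU M_infinite faMle aM).
  by apply: subset_card_le => k nIk; have [ak|nak] := pselect (f a k); [right|left].
apply: chain_inter_nsplit; split; rewrite card_eq_le; apply/andP; split => //.
- exact: card_le_trans (card_leT _) KN.
- have KNe : [set: K] #= [set: N].
    rewrite card_eq_le KN -(card_le_eql faN); exact: card_leT.
  rewrite -(card_le_eql KNe); apply: (infinite_card_setD (B := ~` I)).
  + by rewrite (eq_finite_set KNe).
  + by move=> KI; exact: KM (card_le_trans KI IM).
  + by rewrite setUC setUv.
- by rewrite -(card_le_eql faM); apply: subset_card_le => k nk Ik; exact/nk/Ik.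
Qed.

End MaximalChain.

(** * The chain of initial sets of jumps *)

Section JumpChain.
Context {d : Order.disp_t} {L : orderType d} {K : Type}.
Variables (g : L -> K) (R : set K).
Hypothesis L_wb : weakly_boolean L.
Let J : set L := jump_ends setT.
Variable x0 : L.
Hypothesis g_inj : forall e e', J e -> J e' -> g e = g e' -> e = e'.
Hypothesis gJR : forall e, J e -> ~ R (g e).

(** [R] is padding common to all members: empty in the first two cases of the theorem, the
    complement of the image of [J] in the third. *)
Definition jump_chain (x : L) : set K := R `|` g @` [set e | J e /\ e <= x].

Lemma jump_chain_ends x e : J e -> jump_chain x (g e) -> e <= x.
Proof. by move=> Je [/(gJR Je)//|[e' [Je' e'x] /(g_inj Je' Je) <-]]. Qed.

(** If [y < x], some jump lies between them, and its right end is recorded at [x] but not at [y]. *)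
Lemma jump_chain_le x y : x <= y <-> jump_chain x `<=` jump_chain y.
Proof.
split=> [xy k [Rk|[e [Je ex] <-]]|xy]; first by left.
  by right; exists e => //; split=> //; exact: le_trans ex xy.
rewrite leNgt; apply/negP => /(L_wb.2)[c [e [yc ce ex ce0]]].
have Je : J e by split=> //; exists c.
have /(jump_chain_ends Je) ey : jump_chain y (g e) by apply: xy; right; exists e.
by move: ce; rewrite ltNge (le_trans ey yc).
Qed.

Lemma setC_jump_chain x :
  ~` jump_chain x = ~` (R `|` g @` J) `|` g @` [set e | J e /\ x < e].
Proof.
apply/seteqP; split=> k.
  move=> nk; have [[e Je ek]|nJ] := pselect ((g @` J) k).
    right; exists e => //; split=> //; rewrite ltNge; apply/negP => ex.
    by apply: nk; right; exists e.
  by left => -[Rk|//]; apply: nk; left.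
move=> [nk|[e [Je xe] <-]].
  by move=> [Rk|[e [Je _] ek]]; apply: nk; [left|right; exists e].
by move=> /(jump_chain_ends Je); rewrite leNgt xe.
Qed.

(** Let [s] be the supremum of the points whose member lies inside [Z]. Either [Z] is the member at
    [s], or a further point [g e] of [Z] forces [e] to be the immediate successor of [s], and [Z] is
    the member at [e]. *)
Lemma jump_chain_comparable Z : ~ (Z `<=` R) -> ~ (R `|` g @` J `<=` Z) ->
  (forall x, Z `<=` jump_chain x \/ jump_chain x `<=` Z) -> range jump_chain Z.
Proof.
move=> ZR JZ Zf; pose A := [set x | jump_chain x `<=` Z].
have nA x : ~ A x -> Z `<=` jump_chain x by case: (Zf x).
have ndc c e : jump c e -> J e -> ~ jump_chain c (g e).
  by move=> ce Je /(jump_chain_ends Je); rewrite leNgt ce.1.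
(* A point of [Z] outside [R] would be some [g e], which the member at the left end of that jump
   misses. *)
have [a Aa] : A !=set0.
  apply: contrapT => /forallNP A0; apply: ZR => k Zk; apply: contrapT => nRk.
  have [//|[e [Je _] ek]] := nA x0 (A0 x0) k Zk.
  case: (Je) => _ [c _ ce]; apply: (ndc _ _ ce Je); rewrite ek.
  exact: nA (A0 c) k Zk.
have [b nAb] : exists b, ~ A b.
  apply: contrapT => /forallNP nA'; have {}A_ x : A x by exact: contrapT (nA' x).
  apply: JZ => k [Rk|[e Je <-]]; first by apply: (A_ x0); left.
  by apply: (A_ e); right; exists e.
have Ab x : A x -> x <= b.
  by move=> Ax; apply/jump_chain_le => k /Ax; exact: nA.
have [s [sA smin]] : supremums A !=set0.
  by apply: L_wb.1; [exists a|exists b].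
(* A missing [g e] with [e <= s] would make the left end [c < s] an upper bound of [A]. *)
have As : A s.
  move=> k [Rk|[e [Je es] <-]]; first by apply: Aa; left.
  case: (Je) => _ [c _ ce]; apply: contrapT => nZe.
  have /smin : ubound A c.
    move=> x Ax; apply: (jump_le ce); rewrite ltNge; apply/negP => ex.
    by apply/nZe/Ax; right; exists e.
  by rewrite leNgt (lt_le_trans ce.1 es).
have [Zs|/existsNP[k /not_implyP[Zk nsk]]] := pselect (Z `<=` jump_chain s).
  by exists s => //; apply/seteqP; split.
have Z_gt y : s < y -> Z `<=` jump_chain y.
  by move=> sy; apply: nA => /sA; rewrite leNgt sy.
have nRk : ~ R k by move=> Rk; apply: nsk; left.
have sb : s < b by rewrite lt_neqAle Ab// andbT; apply/eqP => sb; rewrite -sb in nAb.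
have [//|[e [Je eb] ek]] := Z_gt b sb k Zk.
have se : s < e.
  by rewrite ltNge; apply/negP => es; apply: nsk; right; exists e.
exists e => //; apply/seteqP; split; last exact: Z_gt.
move=> j [Rj|[e' [Je' e'e] <-]]; first by apply: As; left.
have [e's|se'] := leP e' s; first by apply: As; right; exists e'.
(* [g e] lies in [Z], hence in the member at every point above [s], in particular at [e']; so
   [e <= e']. *)
suff -> : e' = e by rewrite ek.
apply/eqP; rewrite eq_le e'e; apply: jump_chain_ends => //.
by rewrite ek; exact: Z_gt.
Qed.

(** The second hypothesis excludes candidates lying below or above the whole chain, so a set of the
    poset comparable with all members is itself a member. *)
Lemma jump_chain_maximal (N M : Type) :
  (forall x, split_subsets K N M (jump_chain x)) ->
  (forall Z, split_subsets K N M Z -> ~ (Z `<=` R) /\ ~ (R `|` g @` J `<=` Z)) ->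
  iso_to_maximal_chain L (split_subsets K N M).
Proof.
move=> fP Pproper; exists (range jump_chain); last first.
  by exists jump_chain; split=> //; exact: jump_chain_le.
split=> [_ [x _ <-]//|_ _ [x _ <-] [y _ <-]|C CP Ctot fC].
  by case/orP: (le_total x y) => /jump_chain_le; [left|right].
apply/seteqP; split=> // Z CZ; have [ZR JZ] := Pproper Z (CP _ CZ).
by apply: jump_chain_comparable => // x; apply: Ctot => //; apply: fC; exists x.
Qed.

End JumpChain.

(** * The three equivalences *)

Lemma card_setC_lt K (A : set K) : infinite_set [set: K] -> ~ ([set: K] #<= A) ->
  ~` A #= [set: K].
Proof.
move=> Kinf KA; rewrite card_eq_le card_leT /=.
by apply: (infinite_card_setD (B := A)) => //; rewrite setUv.
Qed.

Lemma card_eqW T U (A : set T) (B : set U) : A #= B -> A #<= B.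
Proof. by case/card_eqPle. Qed.

Lemma infinite_set_card_eq T U (A : set T) (B : set U) :
  infinite_set B -> A #= B -> infinite_set A.
Proof. by move=> Binf AB; rewrite (eq_finite_set AB). Qed.

Section MainTheorem.
Context {d : Order.disp_t} {L : orderType d} {K Lam : Type}.
Hypotheses (Lam_infinite : infinite_set [set: Lam]) (Lam_lt_K : card_lt Lam K).
Variable x0 : L.
Let J : set L := jump_ends setT.
Let J_le x := [set e | J e /\ e <= x].
Let J_gt x := [set e | J e /\ x < e].

Let K_infinite : infinite_set [set: K].
Proof. by move=> Kfin; exact: Lam_infinite (card_le_finite Lam_lt_K.1 Kfin). Qed.

Let succ_infinite S : is_succ_cardinal Lam S -> infinite_set [set: S].
Proof. by move=> [[LamS _] _] Sfin; exact: Lam_infinite (card_le_finite LamS Sfin). Qed.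

Let card_J S : infinite_set [set: S] -> J_le x0 #<= [set: S] -> J_gt x0 #<= [set: S] ->
  J #<= [set: S].
Proof.
move=> Sinf Sl Su; apply: card_le_trans (infinite_card_setU Sinf Sl Su).
by apply: subset_card_le => e Je; have [ex|xe] := leP e x0; [left|right].
Qed.

(** [S] embeds into [K] because [K] is a cardinal above [Lam] and [S] is the least one. *)
Let J_embedding S : is_succ_cardinal Lam S -> J_le x0 #<= [set: S] ->
  J_gt x0 #<= [set: S] ->
  exists g : L -> K, forall e e', J e -> J e' -> g e = g e' -> e = e'.
Proof.
move=> Ssucc Sl Su; have JS := card_J (succ_infinite Ssucc) Sl Su.
have JK := card_le_trans JS (Ssucc.2 _ Lam_lt_K).
by have [g _ gi] := card_le_fun (infinite_setN0 K_infinite) JK; exists g.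
Qed.

Let card_image_J (g : L -> K) (A : set L) : A `<=` J ->
  (forall e e', J e -> J e' -> g e = g e' -> e = e') -> g @` A #= A.
Proof. by move=> AJ gi; apply: card_image_inj => e e' /AJ Je /AJ Je'; exact: gi. Qed.

(** Serves to exclude from the poset the sets that contain the image of [J], or whose complement
    contains it. *)
Let succ_image_nle S (g : L -> K) (A : set L) (Z : set K) : is_succ_cardinal Lam S ->
  A #= [set: S] -> A `<=` J ->
  (forall e e', J e -> J e' -> g e = g e' -> e = e') ->
  g @` J `<=` Z -> ~ (Z #<= [set: Lam]).
Proof.
move=> [[_ SLam] _] AS AJ gi JZ ZLam; apply: SLam.
rewrite -(card_le_eql AS) -(card_le_eql (card_image_J AJ gi)).
apply: card_le_trans ZLam; apply: subset_card_le => _ [e Ae <-].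
by apply: JZ; exists e => //; exact: AJ.
Qed.

Let J_leJ x : J_le x `<=` J. Proof. by move=> e []. Qed.
Let J_gtJ x : J_gt x `<=` J. Proof. by move=> e []. Qed.

Lemma maximal_chain_full : iso_to_maximal_chain L (split_subsets K K K) <->
  weakly_boolean L /\
  (forall a : L, has_weight (lower_ray a) K /\ has_weight (upper_ray a) K).
Proof.
split=> [[C Cmax [f [fC fle]]]|[wb wL]].
  subst C; have wb := chain_weakly_boolean Cmax fle; split=> // a; split.
    apply/(has_weight_lower a wb.2 K_infinite).
    apply: card_eq_trans (card_jumps_lower K_infinite K_infinite Cmax fle a) _.
    exact: (card_lower_full K_infinite K_infinite Cmax (card_lexx _)).
  apply/(has_weight_upper a wb.2 K_infinite).
  apply: card_eq_trans (card_jumps_upper K_infinite K_infinite Cmax fle a) _.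
  exact: (card_upper_full K_infinite K_infinite Cmax (card_lexx _)).
have Jl x : J_le x #= [set: K] := (has_weight_lower x wb.2 K_infinite).1 (wL x).1.
have Ju x : J_gt x #= [set: K] := (has_weight_upper x wb.2 K_infinite).1 (wL x).2.
have JK : J #= [set: K].
  rewrite card_eq_le (card_J K_infinite (card_eqW (Jl x0)) (card_eqW (Ju x0))) /=.
  by rewrite -(card_le_eql (Jl x0)); apply: subset_card_le; exact: J_leJ.
(* With [g] onto [K] and empty padding, the two extremes to exclude are the empty set and [K]
   itself. *)
have [g [_ gi gs]] := card_eq_fun (infinite_setN0 K_infinite) JK.
have gJ : set0 `|` g @` J = [set: K].
  by apply/seteqP; split=> // k _; right; exact: gs.
have gJR e : J e -> ~ (set0 : set K) (g e) by move=> _; case.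
apply: (jump_chain_maximal wb x0 gi gJR) => [x|Z [ZK ZcK]].
  split; last rewrite setC_jump_chain// gJ setCT set0U.
    by rewrite /jump_chain set0U; exact: card_eq_trans (card_image_J (@J_leJ x) gi) (Jl x).
  exact: card_eq_trans (card_image_J (@J_gtJ x) gi) (Ju x).
split=> [Z0|].
  by have [k /Z0] := infinite_setN0 (infinite_set_card_eq K_infinite ZK).
rewrite gJ => TZ.
by have [k] := infinite_setN0 (infinite_set_card_eq K_infinite ZcK); apply; exact: TZ.
Qed.

Lemma maximal_chain_small : iso_to_maximal_chain L (split_subsets K Lam K) <->
  weakly_boolean L /\
  (forall a : L, has_weight (lower_ray a) Lam /\ has_succ_weight (upper_ray a) Lam).
Proof.
have [LamK KLam] := Lam_lt_K.
split=> [[C Cmax [f [fC fle]]]|[wb wL]].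
  subst C; have wb := chain_weakly_boolean Cmax fle; split=> // a; split.
    apply/(has_weight_lower a wb.2 Lam_infinite).
    apply: card_eq_trans (card_jumps_lower Lam_infinite K_infinite Cmax fle a) _.
    exact: (card_lower_full Lam_infinite K_infinite Cmax (card_lexx _)).
  have Ssucc := card_upper_succ Lam_infinite K_infinite Cmax fle (card_lexx _) KLam a.
  (* The successor of [Lam] is the set of points added above [f a], read as a type. *)
  exists (\bigcup_x f x `\` f a) => //.
  apply/(has_weight_upper a wb.2 (succ_infinite Ssucc)).
  apply: card_eq_trans (card_jumps_upper Lam_infinite K_infinite Cmax fle a) _.
  exact: card_setT_sym.
have Jl x : J_le x #= [set: Lam] := (has_weight_lower x wb.2 Lam_infinite).1 (wL x).1.
have [S Ssucc Sw] := (wL x0).2.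
have Ju : J_gt x0 #= [set: S] := (has_weight_upper x0 wb.2 (succ_infinite Ssucc)).1 Sw.
have [g gi] := J_embedding Ssucc (card_le_trans (card_eqW (Jl x0)) Ssucc.1.1) (card_eqW Ju).
have gJR e : J e -> ~ (set0 : set K) (g e) by move=> _; case.
apply: (jump_chain_maximal wb x0 gi gJR) => [x|Z [ZLam ZcK]].
  have fLam : jump_chain g set0 x #= [set: Lam].
    by rewrite /jump_chain set0U; exact: card_eq_trans (card_image_J (@J_leJ x) gi) (Jl x).
  by split=> //; apply: card_setC_lt => //; rewrite (card_le_eqr fLam).
split=> [Z0|].
  by have [k /Z0] := infinite_setN0 (infinite_set_card_eq Lam_infinite ZLam).
rewrite set0U => JZ.
exact: (succ_image_nle Ssucc Ju (@J_gtJ x0) gi JZ) (card_eqW ZLam).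
Qed.

Lemma maximal_chain_cosmall : iso_to_maximal_chain L (split_subsets K K Lam) <->
  weakly_boolean L /\
  (forall a : L, has_succ_weight (lower_ray a) Lam /\ has_weight (upper_ray a) Lam).
Proof.
have [LamK KLam] := Lam_lt_K.
split=> [[C Cmax [f [fC fle]]]|[wb wL]].
  subst C; have wb := chain_weakly_boolean Cmax fle; split=> // a; split.
    have Ssucc := card_lower_succ K_infinite Lam_infinite Cmax fle (card_lexx _) KLam a.
    exists (f a `\` \bigcap_x f x) => //.
    apply/(has_weight_lower a wb.2 (succ_infinite Ssucc)).
    apply: card_eq_trans (card_jumps_lower K_infinite Lam_infinite Cmax fle a) _.
    exact: card_setT_sym.
  apply/(has_weight_upper a wb.2 Lam_infinite).
  apply: card_eq_trans (card_jumps_upper K_infinite Lam_infinite Cmax fle a) _.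
  exact: (card_upper_full K_infinite Lam_infinite Cmax (card_lexx _)).
have Ju x : J_gt x #= [set: Lam] := (has_weight_upper x wb.2 Lam_infinite).1 (wL x).2.
have [S Ssucc Sw] := (wL x0).1.
have Jl : J_le x0 #= [set: S] := (has_weight_lower x0 wb.2 (succ_infinite Ssucc)).1 Sw.
have [g gi] := J_embedding Ssucc (card_eqW Jl) (card_le_trans (card_eqW (Ju x0)) Ssucc.1.1).
(* Padding with all points outside the image of [J] leaves in the complement of a member only the
   images of later jump ends, which are [Lam] many. *)
have gJ : ~` (g @` J) `|` g @` J = [set: K] by rewrite setUC setUv.
have gJR e : J e -> ~ (~` (g @` J)) (g e) by move=> Je; apply; exists e.
apply: (jump_chain_maximal wb x0 gi gJR) => [x|Z [ZK ZcLam]].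
  have cfLam : ~` jump_chain g (~` (g @` J)) x #= [set: Lam].
    rewrite setC_jump_chain// gJ setCT set0U.
    exact: card_eq_trans (card_image_J (@J_gtJ x) gi) (Ju x).
  split=> //; rewrite -[jump_chain _ _ _]setCK.
  by apply: card_setC_lt => //; rewrite (card_le_eqr cfLam).
split=> [ZR|].
  apply: (succ_image_nle Ssucc Jl (@J_leJ x0) gi _ (card_eqW ZcLam)).
  by move=> k Jk /ZR.
rewrite gJ => TZ.
by have [k] := infinite_setN0 (infinite_set_card_eq Lam_infinite ZcLam); apply; exact: TZ.
Qed.

End MainTheorem.

Theorem theorem3p2 (K Lam : Type)
    (Lam_infinite : infinite_set [set: Lam])
    (Lam_lt_K : card_lt Lam K)
    (d : Order.disp_t) (L : orderType d) (L_nonempty : [set: L] !=set0) :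
  [/\ iso_to_maximal_chain L (split_subsets K K K) <->
      weakly_boolean L /\
      (forall a : L, has_weight (lower_ray a) K /\ has_weight (upper_ray a) K),
      iso_to_maximal_chain L (split_subsets K Lam K) <->
      weakly_boolean L /\
      (forall a : L,
         has_weight (lower_ray a) Lam /\ has_succ_weight (upper_ray a) Lam)
    & iso_to_maximal_chain L (split_subsets K K Lam) <->
      weakly_boolean L /\
      (forall a : L,
         has_succ_weight (lower_ray a) Lam /\ has_weight (upper_ray a) Lam)].
Proof.
have [x0 _] := L_nonempty; split.
- exact: maximal_chain_full Lam_infinite Lam_lt_K x0.
- exact: maximal_chain_small.
- exact: maximal_chain_cosmall.
Qed.
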